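(* There exists a stationary random smooth vector field on $\mathbb{R}^2$ such that, almost surely, its divergence is equal to $1$ everywhere on $\mathbb{R}^2$.
   Context: A random smooth vector field on $\mathbb{R}^2$ is a random element $V$ of the space of smooth ($C^\infty$) maps $\mathbb{R}^2 \to \mathbb{R}^2$, $V = (V_1,V_2)$; its divergence is $\operatorname{div} V = \partial V_1/\partial x + \partial V_2/\partial y$. It is stationary if it is shift-invariant in distribution: for every $z \in \mathbb{R}^2$ the random field $V(\cdot + z)$ has the same distribution as $V(\cdot)$. No moment assumptions are made. *)

(* Defs.v *)
From HB Require Import structures.
From mathcomp Require Import all_boot all_order all_algebra.
From mathcomp Require Import all_classical all_reals all_analysis.

Set Implicit Arguments.
Unset Strict Implicit.
Unset Printing Implicit Defensive.

Import Order.TTheory GRing.Theory Num.Theory.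
Import numFieldNormedType.Exports.

Local Open Scope classical_set_scope.
Local Open Scope ring_scope.

Section SmoothFields.
Variable R : realType.

Definition dir_x : R * R := (1, 0).
Definition dir_y : R * R := (0, 1).

Definition partial_x (f : R * R -> R) (z : R * R) : R := 'D_dir_x f z.
Definition partial_y (f : R * R -> R) (z : R * R) : R := 'D_dir_y f z.

(* 'D_v f z is a total function, with a junk value where the limit does not
   exist, so the existence of the partial derivatives is required explicitly. *)
Fixpoint class_C (k : nat) (f : R * R -> R) : Prop :=
  match k with
  | 0 => continuous f
  | k'.+1 => [/\ forall z, derivable f z dir_x,
                 forall z, derivable f z dir_y,
                 class_C k' (partial_x f) &
                 class_C k' (partial_y f)]
  end.

Definition smooth (f : R * R -> R) : Prop := forall k, class_C k f.

Record smooth_field := SmoothField {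
  field_fun :> R * R -> R * R;
  smooth_comp1 : smooth (fun z => (field_fun z).1);
  smooth_comp2 : smooth (fun z => (field_fun z).2) }.

Definition divergence (V : smooth_field) (z : R * R) : R :=
  partial_x (fun u => (V u).1) z + partial_y (fun u => (V u).2) z.

Lemma class_C_cst0 k : class_C k (fun=> 0).
Proof.
elim: k => [|k IHk] /=; first by move=> z; exact: cvg_cst.
have D v z : 'D_v (fun _ : R * R => 0 : R) z = 0 by exact: derive_cst.
have -> : partial_x (fun=> 0) = (fun=> 0) by apply/funext => z; exact: D.
have -> : partial_y (fun=> 0) = (fun=> 0) by apply/funext => z; exact: D.
by split=> // z; exact: derivable_cst.
Qed.

Definition zero_field : smooth_field :=
  @SmoothField (fun=> (0, 0)) (fun k => class_C_cst0 k) (fun k => class_C_cst0 k).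

Lemma class_C_shift a k f : class_C k f -> class_C k (fun z => f (z + a)).
Proof.
have Q v g z : (fun h : R => h^-1 *: (((fun u => g (u + a)) \o shift z) (h *: v)
      - g (z + a))) = (fun h => h^-1 *: ((g \o shift (z + a)) (h *: v) - g (z + a)))
      :> (R -> R).
  by apply/funext => h /=; rewrite addrA.
elim: k f => [|k IHk] f /=.
  move=> cf z; have ca : (fun u : R * R => u + a) @ z --> z + a.
    by apply: cvgD; [exact: cvg_id|exact: cvg_cst].
  exact: (cvg_comp _ _ ca (cf (z + a))).
move=> [dx dy Cx Cy].
have -> : partial_x (fun u => f (u + a)) = (fun u => partial_x f (u + a)).
  by apply/funext => z; rewrite /partial_x /derive Q.
have -> : partial_y (fun u => f (u + a)) = (fun u => partial_y f (u + a)).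
  by apply/funext => z; rewrite /partial_y /derive Q.
by split; [move=> z; rewrite /derivable Q; exact: dx
          |move=> z; rewrite /derivable Q; exact: dy| exact: IHk | exact: IHk].
Qed.

Definition shift_field (a : R * R) (V : smooth_field) : smooth_field :=
  @SmoothField (fun z => V (z + a))
    (fun k => class_C_shift a (smooth_comp1 V k))
    (fun k => class_C_shift a (smooth_comp2 V k)).

(* The space of smooth fields carries the sigma-algebra generated by the
   evaluations V |-> V z; it coincides with the Borel sigma-algebra of the usual
   Frechet topology. *)
Definition cylinders : set (set smooth_field) :=
  [set A | exists z (B : set (measurableTypeR R * measurableTypeR R)),
     measurable B /\ A = [set V : smooth_field | B (V z)]].

HB.instance Definition _ := gen_eqMixin smooth_field.
HB.instance Definition _ := gen_choiceMixin smooth_field.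
HB.instance Definition _ := isPointed.Build smooth_field zero_field.
HB.instance Definition _ :=
  Measurable.copy smooth_field (g_sigma_algebraType cylinders).

Lemma measurable_shift_field (a : R * R) :
  measurable_fun [set: smooth_field] (shift_field a).
Proof.
apply: (@measurability _ _ smooth_field smooth_field _ _ cylinders erefl).
move=> _ [_ [z [B [mB ->]]] <-]; rewrite setTI.
by apply: sub_sigma_algebra; exists (z + a), B.
Qed.

HB.instance Definition _ (a : R * R) :=
  isMeasurableFun.Build _ _ smooth_field smooth_field (shift_field a)
    (measurable_shift_field a).

Definition stationary (d : measure_display) (T : measurableType d)
    (P : probability T R) (V : {RV P >-> smooth_field}) : Prop :=
  forall (a : R * R) (A : set smooth_field), measurable A ->
    distribution P (shift_field a \o V) A = distribution P V A.

End SmoothFields.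

(* Main.v *)
Require Import Defs.
From HB Require Import structures.
From mathcomp Require Import all_boot all_order all_algebra.
From mathcomp Require Import all_classical all_reals all_analysis.
From mathcomp Require Import measurable_realfun.
From mathcomp Require Import ring lra zify.

(** A field of divergence 1 is assembled from functions of one variable.  Let
beta_n (n = 0, 1, ...) be smooth periodic sawtooth waves on the line, of slope
1 except on short gaps, with random phases and with periods growing
geometrically while the gaps keep length 1.  Almost surely any bounded
interval misses the gaps of all but finitely many beta_n.  Put b_0 = beta_0 and
b_n = beta_n - beta_(n-1), and let eta_n be a second family like beta_n.  Then

   V_1 (x, y) = sum_n b_n(x) (1 - eta_n'(y)),
   V_2 (x, y) = sum_n b_n'(x) eta_n(y)

are locally finite sums: on a bounded set 1 - eta_n' and b_n' vanish for all
large n.  So V is smooth, and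

   div V = sum_n b_n' (1 - eta_n') + sum_n b_n' eta_n' = sum_n b_n',

a telescoping sum whose partial sums beta_n' are eventually equal to 1 locally
(divergence_approx, divergence_phase_field).

Shifting V by (x, y) rotates the phase of each beta_n and each eta_n.  To make
this rotation act on a finite-dimensional space, the phases of the beta_n are
taken to be characters of a two-dimensional torus: with
freq n = (sqrt 2 - 1)^(n+1) = k_n + l_n sqrt 2 for integers k_n, l_n, the
phase p_n = k_n w_1 + l_n w_2 mod 1 increases by freq n * x when (w_1, w_2) is
translated by (x, sqrt 2 x).  The wave beta_n therefore has frequency freq n,
which is arbitrarily small although only two independent circles are used, and
stationarity is the invariance of the uniform measure under translations
(phase_field_shifted, prod_preserving).  A second torus carries the phases of
the eta_n.

Each phase is uniformly distributed modulo 1 (frac_phase_uniform), so it comes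
within m * freq n of an integer with probability at most 2 m freq n.  These
numbers are summable in n, and the Borel-Cantelli lemma gives the almost sure
property of the gaps stated above (ae_good).  On the exceptional event, which
is invariant under shifts, V is the zero field. *)

Set Implicit Arguments.
Unset Strict Implicit.
Unset Printing Implicit Defensive.

Import Order.TTheory GRing.Theory Num.Theory.
Import numFieldNormedType.Exports.

Local Open Scope classical_set_scope.
Local Open Scope ring_scope.

(** * Functions of class C^k on the line *)

Section SmoothLine.
Variable R : realType.
Implicit Types (f g : R -> R) (k : nat).

(** One-variable counterpart of class_C. *)
Fixpoint class_C1 k f : Prop :=
  if k is k'.+1 then (forall x, derivable f x 1) /\ class_C1 k' (derive1 f)
  else continuous f.

Lemma derivable_continuous f : (forall x, derivable f x 1) -> continuous f.
Proof. by move=> df x; apply/differentiable_continuous/derivable1_diffP. Qed.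

Lemma class_C1_continuous k f : class_C1 k f -> continuous f.
Proof. by case: k => [//|k] [df _]; exact: derivable_continuous. Qed.

Lemma class_C1W k f : class_C1 k.+1 f -> class_C1 k f.
Proof.
elim: k f => [|k IHk] f; first by case=> /derivable_continuous.
by move=> [df Cf]; split => //; exact: IHk.
Qed.

Lemma class_C1_cst k (c : R) : class_C1 k (fun=> c).
Proof.
elim: k c => [|k IHk] c /=; first by move=> x; exact: cvg_cst.
split=> [x|]; first exact: derivable_cst.
have -> : derive1 (fun=> c : R) = (fun=> 0).
  by apply/funext => x; exact: derive1_cst.
exact: IHk.
Qed.

Lemma class_C1_id k : class_C1 k (fun x => x).
Proof.
case: k => [|k] /=; first by move=> x; exact: cvg_id.
split=> [x|]; first exact: derivable_id.
have -> : derive1 (fun x : R => x) = (fun=> 1).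
  by apply/funext => x; exact: derive1_id.
exact: class_C1_cst.
Qed.

Lemma class_C1D k f g :
  class_C1 k f -> class_C1 k g -> class_C1 k (fun x => f x + g x).
Proof.
elim: k f g => [|k IHk] f g /=;
  first by move=> cf cg x; apply: cvgD; [exact: cf|exact: cg].
move=> [df Cf] [dg Cg]; split=> [x|]; first exact: derivableD.
have -> : derive1 (fun x => f x + g x) = (fun x => derive1 f x + derive1 g x).
  by apply/funext => x; rewrite !derive1E; exact: deriveD.
exact: IHk.
Qed.

Lemma class_C1M k f g :
  class_C1 k f -> class_C1 k g -> class_C1 k (fun x => f x * g x).
Proof.
elim: k f g => [|k IHk] f g;
  first by move=> cf cg x; apply: cvgM; [exact: cf|exact: cg].
move=> Cf Cg; case: (Cf) (Cg) => [df Cf'] [dg Cg'].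
split=> [x|]; first exact: derivableM.
have -> : derive1 (fun x => f x * g x) =
    (fun x => f x * derive1 g x + g x * derive1 f x).
  by apply/funext => x; rewrite !derive1E; exact: deriveM.
by apply: class_C1D; apply: IHk => //; exact: class_C1W.
Qed.

Lemma class_C1B k (f g : R -> R) :
  class_C1 k f -> class_C1 k g -> class_C1 k (fun x => f x - g x).
Proof.
move=> Cf Cg; have -> : (fun x => f x - g x) = (fun x => f x + -1 * g x).
  by apply/funext => x; rewrite mulN1r.
by apply: class_C1D => //; apply: class_C1M => //; exact: class_C1_cst.
Qed.

Lemma class_C1_affine k (b c : R) : class_C1 k (fun x => b + c * x).
Proof.
apply: class_C1D; first exact: class_C1_cst.
by apply: class_C1M; [exact: class_C1_cst|exact: class_C1_id].
Qed.

Lemma class_C1_comp k f g :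
  class_C1 k f -> class_C1 k g -> class_C1 k (fun x => f (g x)).
Proof.
elim: k f g => [|k IHk] f g.
  by move=> cf cg x; apply: continuous_comp; [exact: cg|exact: cf].
move=> Cf Cg; case: (Cf) (Cg) => [df Cf'] [dg Cg'].
split=> [x|].
  by apply/derivable1_diffP/differentiable_comp; exact/derivable1_diffP.
have -> : derive1 (fun x => f (g x)) = (fun x => derive1 f (g x) * derive1 g x).
  by apply/funext => x; exact: derive1_comp.
by apply: class_C1M => //; apply: IHk => //; exact: class_C1W.
Qed.

(** The factor w^-1 compensates the change of scale, so that the slopes of S
    are kept. *)
Lemma is_derive_rescale (S : R -> R) (w b x : R) : w != 0 ->
  (forall y, derivable S y 1) ->
  is_derive x 1 (fun y => w^-1 * S (b + w * y)) (derive1 S (b + w * x)).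
Proof.
move=> w0 dS.
have dI : derivable (fun y : R => y) x 1 by exact: derivable_id.
have dK (c : R) : derivable (fun=> c) x 1 by exact: derivable_cst.
have dM : derivable (fun y : R => w * y) x 1.
  apply: (derivableM (f := fun=> w) (g := fun y => y)); first exact: dK.
  exact: dI.
have vM : 'D_1 (fun y : R => w * y) x = w.
  rewrite (deriveM (f := fun=> w) (g := fun y => y) (dK w) dI).
  by rewrite derive_cst derive_id scaler0 addr0 /GRing.scale/= mulr1.
have dA : derivable (fun y : R => b + w * y) x 1.
  apply: (derivableD (f := fun=> b) (g := fun y => w * y)).
    exact: dK.
  exact: dM.
have vA : 'D_1 (fun y : R => b + w * y) x = w.
  rewrite (deriveD (f := fun=> b) (g := fun y => w * y) (dK b) dM).
  by rewrite derive_cst add0r.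
have dC : derivable (fun y => S (b + w * y)) x 1.
  apply/derivable1_diffP/(@differentiable_comp _ _ _ _ (fun y => b + w * y)).
    by move/derivable1_diffP: dA.
  by move/derivable1_diffP: (dS (b + w * x)).
apply: DeriveDef.
  by apply: (derivableM (f := fun=> w^-1)); [exact: dK|exact: dC].
rewrite (deriveM (f := fun=> w^-1) (dK w^-1) dC) derive_cst scaler0 addr0.
rewrite -derive1E.
rewrite (derive1_comp (f := fun y => b + w * y) dA (dS _)).
rewrite [X in _ * X]derive1E vA.
by rewrite /GRing.scale/= mulrCA mulVf ?mulr1.
Qed.

(** Being of class C^k is a local property: a function may be checked against a
    different C^k model near each point. *)
Lemma class_C1_near k f :
  (forall x : R, exists2 g : R -> R, class_C1 k g &
     \forall y \near x, g y = f y) ->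
  class_C1 k f.
Proof.
elim: k f => [|k IHk] f H /=.
  move=> x; have [g cg gf] := H x.
  rewrite /continuous_at -(nbhs_singleton gf).
  by apply: cvg_trans (cg x); exact: near_eq_cvg.
split=> [x|].
  by have [g [dg _] gf] := H x; apply: near_eq_derivable (dg x).
apply: IHk => x; have [g [_ Cg] gf] := H x; exists (derive1 g) => //.
apply: filterS (near_join gf) => y gfy.
by rewrite !derive1E; exact: near_eq_derive.
Qed.

End SmoothLine.

(** * A smooth step *)

Section SmoothStep.
Variable R : realType.
Implicit Types (k n : nat) (t : R).

(** The powers t^-n only serve to make the family closed under differentiation;
    the member n = 0 is the classical function exp(-1/t). *)
Definition flat (n : nat) (t : R) : R :=
  if 0 < t then t^-1 ^+ n * expR (- t^-1) else 0.

(** With s = 1/t this is s^(n+1) <= (n+1)! exp s, one term of the exponential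
    series. It gives the derivative at 0. *)
Lemma flat_le n t : 0 <= flat n t <= n.+1`!%:R * `|t|.
Proof.
rewrite /flat; case: ifPn => [t0|_]; last by rewrite lexx mulr_ge0.
have s0 : 0 < t^-1 by rewrite invr_gt0.
apply/andP; split; first by rewrite mulr_ge0 ?expR_ge0// exprn_ge0// ltW.
rewrite expRN gtr0_norm// -[t in leRHS]invrK ler_pdivlMr// mulrAC -exprSr.
rewrite ler_pdivrMr ?expR_gt0// mulrC -ler_pdivrMr ?ltr0n ?fact_gt0//.
by apply: le_trans (expR_ge1Dxn n (ltW s0)); rewrite lerDr.
Qed.

Lemma is_derive_flat n (t : R) :
  is_derive t (1 : R) (flat n) (flat n.+2 t - n%:R * flat n.+1 t).
Proof.
have [t0|t0|->] := ltgtP t 0.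
- rewrite /flat !(lt_gtF t0) mulr0 subr0.
  apply: (near_eq_is_derive (f := fun=> 0)).
    near=> x; rewrite ifF//; apply/lt_gtF; near: x; exact: lt_nbhsl.
- apply: (near_eq_is_derive (f := fun x : R => x^-1 ^+ n * expR (- x^-1))).
    near=> x; rewrite /flat ifT//; near: x; exact: lt_nbhsr.
  rewrite /flat t0.
  have tn0 : t != 0 by rewrite gt_eqF.
  have dV : is_derive t 1 (fun x : R => x^-1) (- t^-1 ^+ 2).
    apply: DeriveDef; first exact: derivableV.
    by rewrite deriveV// derive_id exprVn scaler1.
  have dX := is_deriveX n dV.
  have dE : is_derive t 1 (fun x => expR (- x^-1)) (t^-1 ^+ 2 * expR (- t^-1)).
    have dN : is_derive t 1 (fun x : R => - x^-1) (t^-1 ^+ 2).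
      by rewrite -[X in is_derive _ _ _ X]opprK; exact: is_deriveN.
    have [dN1 dN2] := dN.
    apply: DeriveDef.
      apply/derivable1_diffP.
      apply: (@differentiable_comp _ _ _ _ (fun x : R => - x^-1)).
        exact/derivable1_diffP.
      exact/derivable1_diffP/derivable_expR.
    rewrite -derive1E (@derive1_comp _ (fun x : R => - x^-1))//.
    by rewrite !derive1E dN2 derive_val mulrC.
  have -> : (fun x : R => x^-1 ^+ n * expR (- x^-1)) =
      (fun x : R => x^-1) ^+ n * (fun x => expR (- x^-1)).
    by apply/funext => x; rewrite !fctE.
  apply: is_derive_eq (is_deriveM dX dE) _.
  rewrite /GRing.scale/=.
  rewrite !fctE; move: (_^-1) => s; move: (expR _) => e.
  by case: n {dX} => [|n]; rewrite /= ?expr0 ?exprS; ring.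
- have F0 m : flat m 0 = 0 by rewrite /flat ltxx.
  have lim0 : (fun h : R => h^-1 *: ((flat n \o shift 0) (h *: 1) - flat n 0))
      @ (0 : R)^' --> (0 : R).
    apply: (@squeeze_cvgr _ _ _ _ (fun=> 0) (fun h => n.+2`!%:R * `|h|)).
    + near=> h.
      have hn0 : h != 0 by near: h; exact: nbhs_dnbhs_neq.
      rewrite /= addr0 /GRing.scale/= mulr1 F0 subr0.
      (* the growth rate of flat n at 0 is flat n.+1, which tends to 0 *)
      have -> : h^-1 * flat n h = flat n.+1 h.
        by rewrite /flat; case: ifP => _; rewrite ?mulr0// exprS mulrA.
      exact: flat_le.
    + exact: cvg_cst.
    + have : n.+2`!%:R * `|h| @[h --> (0 : R)^'] --> n.+2`!%:R * `|0 : R|.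
        apply: cvgM; first exact: cvg_cst.
        by apply: cvg_norm; apply: (@cvg_within R (nbhs (0 : R))).
      by rewrite normr0 mulr0.
  rewrite !F0 mulr0 subr0.
  by apply: DeriveDef; [by apply/cvg_ex; exists 0|exact/cvg_lim].
Unshelve. all: by end_near. Qed.

(** The derivative of each member of the family is a combination of two others,
    so induction on k applies to all n at once. *)
Lemma class_C1_flat k n : class_C1 k (flat n).
Proof.
elim: k n => [|k IHk] n.
  by apply: derivable_continuous => x; have [] := is_derive_flat n x.
split=> [x|]; first by have [] := is_derive_flat n x.
have -> : derive1 (flat n) = (fun t => flat n.+2 t + - n%:R * flat n.+1 t).
  apply/funext => t; rewrite derive1E mulNr.
  by have [_ ->] := is_derive_flat n t.
apply: class_C1D; first exact: IHk.
apply: class_C1M; [exact: class_C1_cst|exact: IHk].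
Qed.

Lemma flat_npos n t : t <= 0 -> flat n t = 0.
Proof. by move=> t0; rewrite /flat ltNge t0. Qed.

Lemma flat0_gt0 t : 0 < t -> 0 < flat 0 t.
Proof. by move=> t0; rewrite /flat t0 expr0 mul1r expR_gt0. Qed.

Lemma flat0_homo : {homo flat 0 : s t / s <= t}.
Proof.
move=> s t st; have [s0|s0] := ltP 0 s; last first.
  by rewrite (flat_npos _ s0); case/andP: (flat_le 0 t).
have t0 := lt_le_trans s0 st.
rewrite /flat s0 t0 !expr0 !mul1r ler_expR lerN2.
by rewrite lef_pV2.
Qed.

(** A smooth function equal to 0 for t <= 0 and to 1 for t >= 1: the inner flat
    0 (1 - t) vanishes for t >= 1, and it is at least flat 0 1 for t <= 0, so
    that the outer argument is then nonpositive. *)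
Definition step (t : R) : R :=
  flat 0 (flat 0 1 - flat 0 (1 - t)) / flat 0 (flat 0 1).

Lemma class_C1_step k : class_C1 k step.
Proof.
apply: class_C1M; last exact: class_C1_cst.
apply: (class_C1_comp (g := fun t => flat 0 1 - flat 0 (1 - t))).
  exact: class_C1_flat.
apply: class_C1B; first exact: class_C1_cst.
apply: (class_C1_comp (g := fun t => 1 - t)); first exact: class_C1_flat.
by apply: class_C1B; [exact: class_C1_cst|exact: class_C1_id].
Qed.

Lemma step_le0 t : t <= 0 -> step t = 0.
Proof.
move=> t0; rewrite /step flat_npos ?mul0r// subr_le0.
by apply: flat0_homo; rewrite lerBrDr gerDl.
Qed.

Lemma step_ge1 t : 1 <= t -> step t = 1.
Proof.
move=> t1; rewrite /step (@flat_npos _ (1 - t)) ?subr_le0// subr0 mulfV//.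
by rewrite gt_eqF// !flat0_gt0.
Qed.

End SmoothStep.

(** * A smooth periodic sawtooth *)

Section Sawtooth.
Variable R : realType.
Implicit Types (t s d : R) (m : int).

Definition fracpart t : R := t - (Num.floor t)%:~R.

Lemma fracpart_itv t : 0 <= fracpart t < 1.
Proof.
have := floor_itv t.
by rewrite /fracpart intrD; lra.
Qed.

Lemma fracpartE m t : m%:~R <= t < m%:~R + 1 -> fracpart t = t - m%:~R.
Proof.
move=> tm; rewrite /fracpart (@floor_def _ _ m)// intrD.
by move: tm; rewrite ?intrD.
Qed.

Lemma fracpartDz t m : fracpart (t + m%:~R) = fracpart t.
Proof. by rewrite /fracpart floorDrz ?intr_int// intrKfloor intrD; ring. Qed.

(** Up to a constant, the function t - floor t with its downward jump at each
    integer replaced by a smooth descent on the following interval of length d.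
    *)
Definition saw d t : R := fracpart t - step (fracpart t / d).

Lemma sawDz d t m : saw d (t + m%:~R) = saw d t.
Proof. by rewrite /saw fracpartDz. Qed.

(** Around an integer m the two branches of the sawtooth are given by one
    smooth formula: just before m the step of the previous period is already
    complete, and its value 1 moves the branch based at m - 1 to the branch
    based at m. *)
Lemma sawE d t m : 0 < d < 1 -> m%:~R - 1 + d <= t < m%:~R + 1 ->
  saw d t = t - m%:~R - step ((t - m%:~R) / d).
Proof.
move=> d01 tm; have [mt|tm0] := leP m%:~R t.
  by rewrite /saw (@fracpartE m)//; lra.
have -> : saw d t = (t - (m - 1)%:~R) - step ((t - (m - 1)%:~R) / d).
  by rewrite /saw (@fracpartE (m - 1))// intrB; lra.
rewrite step_ge1; last by rewrite ler_pdivlMr ?intrB; lra.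
rewrite step_le0; first by rewrite intrB; ring.
by rewrite ler_pdivrMr; lra.
Qed.

Lemma class_C1_saw k d : 0 < d < 1 -> class_C1 k (saw d).
Proof.
move=> d01; apply: class_C1_near => t; set m := Num.floor t.
exists (fun s => (s + - m%:~R) + -1 * step (d^-1 * (s + - m%:~R))).
  have CB : class_C1 k (fun s : R => s + - m%:~R).
    by apply: class_C1D; [exact: class_C1_id|exact: class_C1_cst].
  apply: class_C1D => //; apply: class_C1M; first exact: class_C1_cst.
  apply: (class_C1_comp (f := @step R)); first exact: class_C1_step.
  by apply: class_C1M => //; exact: class_C1_cst.
have := floor_itv t; rewrite -/m intrD => /andP[mt tm].
near=> s; rewrite (@sawE _ _ m)//; first by rewrite mulN1r [d^-1 * _]mulrC.
apply/andP; split.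
  by apply: ltW; near: s; apply: lt_nbhsr; lra.
by near: s; apply: lt_nbhsl; lra.
Unshelve. all: by end_near. Qed.

Lemma derive1_saw d t : 0 < d < 1 -> d < fracpart t -> derive1 (saw d) t = 1.
Proof.
move=> d01; rewrite /fracpart; set m := Num.floor t => dt.
have := floor_itv t; rewrite -/m intrD => /andP[mt tm].
rewrite derive1E (@near_eq_derive _ _ _ _ (fun s => s - (m%:~R + 1))).
  by rewrite deriveB// derive_id derive_cst subr0.
near=> s.
have sd : m%:~R + d < s by near: s; apply: lt_nbhsr; lra.
have sm : s < m%:~R + 1 by near: s; apply: lt_nbhsl; lra.
rewrite (@sawE _ _ m)//; last by lra.
rewrite step_ge1; first by ring.
by rewrite ler_pdivlMr; lra.
Unshelve. all: by end_near. Qed.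

Lemma derive1_saw_periodic d t m :
  derive1 (saw d) (t + m%:~R) = derive1 (saw d) t.
Proof.
have Q : (fun h : R => h^-1 *: (saw d (h + (t + m%:~R)) - saw d (t + m%:~R))) =
    (fun h : R => h^-1 *: (saw d (h + t) - saw d t)).
  by apply/funext => h; rewrite addrA !sawDz.
exact: (congr1 (fun F : R -> R => lim (F @ 0^')) Q).
Qed.

End Sawtooth.

(** * Smooth functions on the plane *)

Section SmoothPlane.
Variable R : realType.
Implicit Types (F G : R * R -> R) (f g : R -> R) (k n m : nat) (z : R * R).

Lemma class_CD k F G :
  class_C k F -> class_C k G -> class_C k (fun z => F z + G z).
Proof.
elim: k F G => [|k IHk] F G /=.
  by move=> cF cG x; apply: cvgD; [exact: cF|exact: cG].
move=> [dFx dFy CFx CFy] [dGx dGy CGx CGy].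
split=> [z|z||]; [exact: derivableD|exact: derivableD| |].
  have -> : partial_x (fun z => F z + G z) =
            (fun z => partial_x F z + partial_x G z).
    by apply/funext => z; exact: deriveD.
  exact: IHk.
have -> : partial_y (fun z => F z + G z) =
          (fun z => partial_y F z + partial_y G z).
  by apply/funext => z; exact: deriveD.
exact: IHk.
Qed.

Lemma class_C_sum k (F : nat -> R * R -> R) n :
  (forall i, class_C k (F i)) -> class_C k (fun z => \sum_(i < n) F i z).
Proof.
move=> CF; elim: n => [|n IHn].
  under [X in class_C _ X]funext => z do rewrite big_ord0.
  exact: class_C_cst0.
under [X in class_C _ X]funext => z do rewrite big_ord_recr/=.
by apply: class_CD.
Qed.

(** The growth rate of f(x) g(y) in the direction dir_x is literally that of
    the one-variable function f times a constant. *)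
Lemma is_derive_sep_x f g z : derivable f z.1 1 ->
  is_derive z (dir_x R) (fun u => f u.1 * g u.2) (derive1 f z.1 * g z.2).
Proof.
move=> df; have dc : derivable (fun=> g z.2) z.1 1 by exact: derivable_cst.
have dfg : derivable (fun t => f t * g z.2) z.1 1.
  by apply: (derivableM (f := f) (g := fun=> g z.2)); [exact: df|exact: dc].
have Q : (fun h : R => h^-1 *: (((fun u => f u.1 * g u.2) \o shift z)
      (h *: dir_x R) - f z.1 * g z.2)) =
    (fun h => h^-1 *: (((fun t => f t * g z.2) \o shift z.1) (h *: (1 : R))
      - f z.1 * g z.2)).
  by apply/funext => h /=; rewrite scaler0 add0r.
apply: DeriveDef; first by rewrite /derivable Q.
rewrite /derive Q -[LHS]/('D_1 (fun t => f t * g z.2) z.1).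
rewrite (deriveM (g := fun=> g z.2) df dc) derive_cst scaler0 add0r.
by rewrite derive1E mulrC.
Qed.

Lemma is_derive_sep_y f g z : derivable g z.2 1 ->
  is_derive z (dir_y R) (fun u => f u.1 * g u.2) (f z.1 * derive1 g z.2).
Proof.
move=> dg; have dc : derivable (fun=> f z.1) z.2 1 by exact: derivable_cst.
have dfg : derivable (fun t => f z.1 * g t) z.2 1.
  by apply: (derivableM (f := fun=> f z.1) (g := g)); [exact: dc|exact: dg].
have Q : (fun h : R => h^-1 *: (((fun u => f u.1 * g u.2) \o shift z)
      (h *: dir_y R) - f z.1 * g z.2)) =
    (fun h => h^-1 *: (((fun t => f z.1 * g t) \o shift z.2) (h *: (1 : R))
      - f z.1 * g z.2)).
  by apply/funext => h /=; rewrite scaler0 add0r.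
apply: DeriveDef; first by rewrite /derivable Q.
rewrite /derive Q -[LHS]/('D_1 (fun t => f z.1 * g t) z.2).
by rewrite (deriveM (f := fun=> f z.1) dc dg) derive_cst scaler0 addr0 derive1E.
Qed.

(** The partial derivatives of f(x) g(y) are again products of separated
    variables, f'(x) g(y) and f(x) g'(y). *)
Lemma class_C_sep k f g :
  class_C1 k f -> class_C1 k g -> class_C k (fun z => f z.1 * g z.2).
Proof.
elim: k f g => [|k IHk] f g.
  move=> cf cg z; apply: cvgM.
    by apply: (continuous_comp (f := fst)); [exact: cvg_fst|exact: cf].
  by apply: (continuous_comp (f := snd)); [exact: cvg_snd|exact: cg].
move=> Cf Cg; case: (Cf) (Cg) => [df Cf'] [dg Cg'].
have Dx z := @is_derive_sep_x f g z (df z.1).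
have Dy z := @is_derive_sep_y f g z (dg z.2).
split=> [z|z||]; [by have [] := Dx z|by have [] := Dy z| |].
  have -> : partial_x (fun z => f z.1 * g z.2) =
            (fun z => derive1 f z.1 * g z.2).
    by apply/funext => z; have [_ <-] := Dx z.
  by apply: IHk => //; exact: class_C1W.
have -> : partial_y (fun z => f z.1 * g z.2) =
          (fun z => f z.1 * derive1 g z.2).
  by apply/funext => z; have [_ <-] := Dy z.
by apply: IHk => //; exact: class_C1W.
Qed.

Lemma class_C_near k F :
  (forall z, exists2 G, class_C k G & \forall u \near z, G u = F u) ->
  class_C k F.
Proof.
elim: k F => [|k IHk] F H /=.
  move=> z; have [G cG GF] := H z.
  rewrite /continuous_at -(nbhs_singleton GF).
  by apply: cvg_trans (cG z); exact: near_eq_cvg.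
split=> [z|z||].
- by have [G [dG _ _ _] GF] := H z; apply: near_eq_derivable (dG z).
- by have [G [_ dG _ _] GF] := H z; apply: near_eq_derivable (dG z).
- apply: IHk => z; have [G [_ _ CG _] GF] := H z; exists (partial_x G) => //.
  by apply: filterS (near_join GF) => y GFy; exact: near_eq_derive.
- apply: IHk => z; have [G [_ _ _ CG] GF] := H z; exists (partial_y G) => //.
  by apply: filterS (near_join GF) => y GFy; exact: near_eq_derive.
Qed.

Lemma is_derive_sumE (F : nat -> R * R -> R) (D : nat -> R) z v n :
  (forall j, is_derive z v (F j) (D j)) ->
  is_derive z v (fun u => \sum_(j < n) F j u) (\sum_(j < n) D j).
Proof.
move=> FD; elim: n => [|n IHn].
  under [X in is_derive _ _ X _]funext => u do rewrite big_ord0.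
  by rewrite big_ord0; exact: is_derive_cst.
under [X in is_derive _ _ X _]funext => u do rewrite big_ord_recr/=.
by rewrite big_ord_recr/=; exact: is_deriveD.
Qed.

(** On every bounded set the sequence is eventually constant, uniformly in the
    point; the limit is then smooth without any estimate on derivatives. *)
Definition locally_stable (F : nat -> R * R -> R) := forall m, exists N,
  forall n, (N <= n)%N -> forall z, `|z| <= m%:R -> F n z = F N z.

Lemma locally_stable_sum (F : nat -> R * R -> R) :
  (forall m, exists N, forall n, (N <= n)%N -> forall z, `|z| <= m%:R ->
     F n z = 0) ->
  locally_stable (fun n z => \sum_(j < n) F j z).
Proof.
move=> F0 m; have [N FN] := F0 m; exists N => n Nn z zm.
elim: n Nn => [|n IHn]; first by rewrite leqn0 => /eqP ->.
rewrite leq_eqVlt => /orP[/eqP -> //|]; rewrite ltnS => Nn.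
by rewrite big_ord_recr/= IHn// FN// addr0.
Qed.

Lemma norm_fst_le z (c : R) : `|z| <= c -> `|z.1| <= c.
Proof. by apply: le_trans; rewrite /Num.norm/= le_max lexx. Qed.

Lemma norm_snd_le z (c : R) : `|z| <= c -> `|z.2| <= c.
Proof. by apply: le_trans; rewrite /Num.norm/= le_max lexx orbT. Qed.

Lemma locally_stable_cvg (F : nat -> R * R -> R) z :
  locally_stable F -> cvgn (F ^~ z).
Proof.
move=> sF; have [N FN] := sF (Num.bound `|z|).
apply: (@is_cvg_near_cst _ _ (F N z)).
near=> n; apply: FN; first by near: n; exact: nbhs_infty_ge.
by apply: ltW; exact: archi_boundP.
Unshelve. all: by end_near. Qed.

Lemma locally_stable_lim (F : nat -> R * R -> R) m : locally_stable F ->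
  exists N, forall n, (N <= n)%N -> forall z, `|z| <= m%:R ->
    limn (F ^~ z) = F n z.
Proof.
move=> sF; have [N FN] := sF m; exists N => n Nn z zm.
apply: lim_near_cst => //.
near=> i; rewrite FN// ?[RHS]FN//; near: i; exact: nbhs_infty_ge.
Unshelve. all: by end_near. Qed.

Lemma near_norm_le z : \forall u \near z, `|u| <= (Num.bound `|z|)%:R.
Proof.
have zm := archi_boundP (normr_ge0 z).
have H := @cvgr_norm_lt _ _ _ (nbhs z) _ id z cvg_id _ zm.
by apply: filterS (H _) => u /ltW.
Qed.

Lemma smooth_lim (F : nat -> R * R -> R) :
  (forall n, smooth (F n)) -> locally_stable F ->
  smooth (fun z => limn (F ^~ z)).
Proof.
move=> CF sF k; apply: class_C_near => z.
have [N FN] := locally_stable_lim (Num.bound `|z|) sF.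
exists (F N); first exact: CF.
by apply: filterS (near_norm_le z) => u um; rewrite (FN N).
Qed.

Lemma smooth_field_ext (V W : smooth_field R) : V =1 W -> V = W.
Proof.
case: V W => [V V1 V2] [W W1 W2] /= /funext VW; rewrite -{}VW in W1 W2 *.
by congr SmoothField; exact: Prop_irrelevance.
Qed.

End SmoothPlane.

(** * The field with given phases *)

Section Field.
Variable R : realType.
Implicit Types (p q : nat -> R) (n j k m : nat) (x y a : R) (z : R * R).

(** A power of the unit sqrt 2 - 1 of Z[sqrt 2]: it decays geometrically and is
    an integer combination of 1 and sqrt 2. *)
Definition freq n : R := (Num.sqrt 2 - 1) ^+ n.+1.

Lemma sqrt2_itv : 1 < Num.sqrt (2 : R) < 3 / 2.
Proof.
have s0 : 0 <= Num.sqrt 2 :> R by exact: sqrtr_ge0.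
have s2 : Num.sqrt 2 ^+ 2 = 2 :> R by rewrite sqr_sqrtr.
by apply/andP; split; nra.
Qed.

Lemma freq_itv n : 0 < freq n < 1.
Proof.
have := sqrt2_itv => /andP[s1 s2].
by rewrite exprn_gt0 ?subr_gt0//= exprn_ilt1//; lra.
Qed.

Lemma freq_le n : freq n <= 2^-1 ^+ n.+1.
Proof.
have := sqrt2_itv => /andP[s1 s2].
by apply: lerXn2r; rewrite ?nnegrE//; lra.
Qed.

(** A sawtooth of period 1 / freq n and slope 1, whose gap parameter freq n
    becomes a gap of length 1 after rescaling. *)
Definition wave p n x : R := (freq n)^-1 * saw (freq n) (p n + freq n * x).

(** The derivative of wave, by is_derive_wave. *)
Definition dwave p n x : R := derive1 (saw (freq n)) (p n + freq n * x).

Lemma class_C1_wave k p n : class_C1 k (wave p n).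
Proof.
apply: class_C1M; first exact: class_C1_cst.
apply: (class_C1_comp (f := saw (freq n))); last exact: class_C1_affine.
by apply: class_C1_saw; exact: freq_itv.
Qed.

Lemma class_C1_dwave k p n : class_C1 k (dwave p n).
Proof.
apply: (class_C1_comp (f := derive1 (saw (freq n)))); last first.
  exact: class_C1_affine.
by case: (class_C1_saw k.+1 (freq_itv n)) => _ CS; exact: CS.
Qed.

Lemma is_derive_wave p n x : is_derive x 1 (wave p n) (dwave p n x).
Proof.
apply: is_derive_rescale; first by rewrite gt_eqF//; case/andP: (freq_itv n).
by case: (class_C1_saw 1 (freq_itv n)) => dS _ y; exact: dS.
Qed.

(** The wave preceding wave p n, with 0 preceding the first one, so that the
    increments telescope to wave p n. *)
Definition pwave p n : R -> R := if n is n'.+1 then wave p n' else fun=> 0.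

Definition dpwave p n : R -> R := if n is n'.+1 then dwave p n' else fun=> 0.

Definition increment p n x : R := wave p n x - pwave p n x.

Definition dincrement p n x : R := dwave p n x - dpwave p n x.

Lemma is_derive_increment p n x :
  is_derive x 1 (increment p n) (dincrement p n x).
Proof.
apply: is_deriveB; first exact: is_derive_wave.
by case: n => [|n]; [exact: is_derive_cst|exact: is_derive_wave].
Qed.

Lemma class_C1_increment k p n : class_C1 k (increment p n).
Proof.
apply: class_C1B; first exact: class_C1_wave.
by case: n => [|n]; [exact: class_C1_cst|exact: class_C1_wave].
Qed.

Lemma class_C1_dincrement k p n : class_C1 k (dincrement p n).
Proof.
apply: class_C1B; first exact: class_C1_dwave.
by case: n => [|n]; [exact: class_C1_cst|exact: class_C1_dwave].
Qed.

Lemma sum_dincrement p n x : \sum_(j < n) dincrement p j x = dpwave p n x.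
Proof.
elim: n => [|n IHn]; first by rewrite big_ord0.
by rewrite big_ord_recr/= IHn /dincrement addrC subrK.
Qed.

(** Together with approx2, the partial sums of the two components of the field.
    *)
Definition approx1 p q n z : R :=
  \sum_(j < n) increment p j z.1 * (1 - dwave q j z.2).

Definition approx2 p q n z : R :=
  \sum_(j < n) dincrement p j z.1 * wave q j z.2.

Lemma smooth_approx1 p q n : smooth (approx1 p q n).
Proof.
move=> k; apply: (@class_C_sum _ _
  (fun j z => increment p j z.1 * (1 - dwave q j z.2))) => j.
apply: (class_C_sep (g := fun y => 1 - dwave q j y)).
  exact: class_C1_increment.
by apply: class_C1B; [exact: class_C1_cst|exact: class_C1_dwave].
Qed.

Lemma smooth_approx2 p q n : smooth (approx2 p q n).
Proof.
move=> k; apply: (@class_C_sum _ _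
  (fun j z => dincrement p j z.1 * wave q j z.2)) => j.
by apply: class_C_sep; [exact: class_C1_dincrement|exact: class_C1_wave].
Qed.

(** In div the terms containing the slope of wave q j cancel, and the sum of
    the remaining dincrement p j telescopes. *)
Lemma divergence_approx p q n z :
  partial_x (approx1 p q n) z + partial_y (approx2 p q n) z = dpwave p n z.1.
Proof.
have D1 j : is_derive z (dir_x R)
    (fun z => increment p j z.1 * (1 - dwave q j z.2))
    (dincrement p j z.1 * (1 - dwave q j z.2)).
  have [dI <-] := is_derive_increment p j z.1; rewrite -derive1E.
  exact: (is_derive_sep_x (fun y => 1 - dwave q j y) dI).
have D2 j : is_derive z (dir_y R)
    (fun z => dincrement p j z.1 * wave q j z.2)
    (dincrement p j z.1 * dwave q j z.2).
  have [dI <-] := is_derive_wave q j z.2; rewrite -derive1E.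
  exact: (is_derive_sep_y (dincrement p j) dI).
have [_ E1] := is_derive_sumE n D1; have [_ E2] := is_derive_sumE n D2.
have -> : partial_x (approx1 p q n) z = _ := E1.
have -> : partial_y (approx2 p q n) z = _ := E2.
rewrite -big_split -sum_dincrement; apply: eq_bigr => j _ /=.
by rewrite -mulrDr subrK mulr1.
Qed.

(** The distance from the origin to the nearest gap of the n-th wave tends to
    infinity: on the line, a distance m corresponds to m * freq n in the phase.
    *)
Definition good p := forall m, exists N, forall n, (N <= n)%N ->
  m%:R * freq n < fracpart (p n) < 1 - m%:R * freq n.

Lemma fracpartD_good x (m : R) y : `|y| <= m ->
  m < fracpart x < 1 - m -> fracpart (x + y) = fracpart x + y.
Proof.
rewrite ler_norml => ym xm.
rewrite (@fracpartE _ (Num.floor x)); first by rewrite /fracpart; ring.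
by move: xm; rewrite /fracpart; lra.
Qed.

Lemma freqM_norm n m y : `|y| <= m%:R -> `|freq n * y| <= m%:R * freq n.
Proof.
have /andP[w0 _] := freq_itv n.
by move=> ym; rewrite normrM gtr0_norm// mulrC ler_pM2r.
Qed.

Lemma dwave_good p m : good p -> exists N, forall n, (N <= n)%N ->
  forall x, `|x| <= m%:R -> dwave p n x = 1.
Proof.
(* m.+1 instead of m leaves room for the gap, of length freq n in the phase *)
move=> /(_ m.+1)[N pN]; exists N => n Nn x xm.
have := pN _ Nn; have /andP[w0 _] := freq_itv n.
rewrite -natr1 mulrDl mul1r => pn.
have xn := freqM_norm n xm.
apply: derive1_saw; first exact: freq_itv.
rewrite (fracpartD_good xn); last by lra.
by move: xn; rewrite ler_norml; lra.
Qed.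

Lemma locally_stable_approx1 p q : good q -> locally_stable (approx1 p q).
Proof.
move=> gq; apply: (@locally_stable_sum _
  (fun j z => increment p j z.1 * (1 - dwave q j z.2))) => m.
have [N qN] := dwave_good m gq; exists N => n Nn z /norm_snd_le zm.
by rewrite qN// subrr mulr0.
Qed.

Lemma locally_stable_approx2 p q : good p -> locally_stable (approx2 p q).
Proof.
move=> gp; apply: (@locally_stable_sum _
  (fun j z => dincrement p j z.1 * wave q j z.2)) => m.
have [N pN] := dwave_good m gp; exists N.+1 => -[//|n] Nn z /norm_fst_le zm.
by rewrite /dincrement/= !pN ?subrr ?mul0r// ltnW.
Qed.

(** The zero field is used outside the good phases so that the definition
    commutes with shifts for all phases, not only for almost all of them. *)
Definition field_value p q z : R * R :=
  if `[< good p /\ good q >] then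
    (limn (approx1 p q ^~ z), limn (approx2 p q ^~ z))
  else (0, 0).

Lemma smooth_field_value1 p q : smooth (fun z => (field_value p q z).1).
Proof.
rewrite /field_value; case: asboolP => [[gp gq]|_] /=; last first.
  by move=> k; exact: class_C_cst0.
by apply: smooth_lim; [exact: smooth_approx1|exact: locally_stable_approx1].
Qed.

Lemma smooth_field_value2 p q : smooth (fun z => (field_value p q z).2).
Proof.
rewrite /field_value; case: asboolP => [[gp gq]|_] /=; last first.
  by move=> k; exact: class_C_cst0.
by apply: smooth_lim; [exact: smooth_approx2|exact: locally_stable_approx2].
Qed.

Definition phase_field p q : smooth_field R :=
  SmoothField (smooth_field_value1 p q) (smooth_field_value2 p q).

Lemma divergence_phase_field p q z :
  good p -> good q -> divergence (phase_field p q) z = 1.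
Proof.
move=> gp gq; rewrite /divergence/= /field_value; case: asboolP => [_|[]//].
pose m := Num.bound `|z|.
have [N1 F1] := locally_stable_lim m (locally_stable_approx1 p gq).
have [N2 F2] := locally_stable_lim m (locally_stable_approx2 q gp).
have [N3 pN] := dwave_good m gp.
pose n := (N1 + N2 + N3)%N.
transitivity (partial_x (approx1 p q n.+1) z + partial_y (approx2 p q n.+1) z).
  congr (_ + _); apply: near_eq_derive.
    by apply: filterS (near_norm_le z) => u um /=; rewrite (F1 n.+1)//; lia.
  by apply: filterS (near_norm_le z) => u um /=; rewrite (F2 n.+1)//; lia.
(* the slope of the last wave of the partial sum is 1 at z.1 *)
rewrite divergence_approx/= pN//; first by rewrite /n; lia.
by apply: norm_fst_le; apply/ltW/archi_boundP.
Qed.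

(** The effect on the phases of moving the origin by a; the integer accounts
    for reduction modulo 1. *)
Definition shifted a p p' :=
  forall n, exists m : int, p' n = p n + freq n * a + m%:~R.

Lemma shiftedN a p p' : shifted a p p' -> shifted (- a) p' p.
Proof.
by move=> pp' n; have [m ->] := pp' n; exists (- m); rewrite mulrN mulrNz; ring.
Qed.

(** A shift by a costs at most a constant multiple of freq n in the distance to
    the integers, which the quantifier over m absorbs. *)
Lemma good_shifted a p p' : shifted a p p' -> good p -> good p'.
Proof.
move=> pp' gp m; have [N pN] := gp (m + Num.bound `|a|)%N; exists N => n Nn.
have := pN _ Nn; have [i ->] := pp' n; rewrite fracpartDz.
have an := @freqM_norm n _ a (ltW (archi_boundP (normr_ge0 a))).
have m0 : 0 <= m%:R * freq n.
  by rewrite mulr_ge0// ltW//; case/andP: (freq_itv n).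
rewrite natrD mulrDl => pn.
rewrite (fracpartD_good an); last by lra.
by move: an; rewrite ler_norml; lra.
Qed.

Lemma good_shiftedE a p p' : shifted a p p' -> good p' <-> good p.
Proof.
by move=> pp'; split; apply: good_shifted; [exact: shiftedN|exact: pp'].
Qed.

Lemma phase_shifted a p p' n x : shifted a p p' ->
  exists m : int, p' n + freq n * x = p n + freq n * (x + a) + m%:~R.
Proof. by move=> pp'; have [m ->] := pp' n; exists m; ring. Qed.

Lemma wave_shifted a p p' n x :
  shifted a p p' -> wave p' n x = wave p n (x + a).
Proof.
by move=> /(@phase_shifted _ _ _ n x)[m pE]; rewrite /wave pE sawDz.
Qed.

Lemma dwave_shifted a p p' n x :
  shifted a p p' -> dwave p' n x = dwave p n (x + a).
Proof.
move=> /(@phase_shifted _ _ _ n x)[m pE].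
by rewrite /dwave pE derive1_saw_periodic.
Qed.

Lemma increment_shifted a p p' n x :
  shifted a p p' -> increment p' n x = increment p n (x + a).
Proof.
move=> pp'; rewrite /increment (wave_shifted _ _ pp').
by case: n => [//|n] /=; rewrite (wave_shifted _ _ pp').
Qed.

Lemma dincrement_shifted a p p' n x :
  shifted a p p' -> dincrement p' n x = dincrement p n (x + a).
Proof.
move=> pp'; rewrite /dincrement (dwave_shifted _ _ pp').
by case: n => [//|n] /=; rewrite (dwave_shifted _ _ pp').
Qed.

(** Every ingredient of the field depends on a phase and a position only
    through p n + freq n * x modulo 1, so rotating the phases shifts the field.
    *)
Lemma phase_field_shifted (a : R * R) p p' q q' :
  shifted a.1 p p' -> shifted a.2 q q' ->
  phase_field p' q' = shift_field a (phase_field p q).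
Proof.
move=> pp' qq'; apply: smooth_field_ext => z.
rewrite -[LHS]/(field_value p' q' z) -[RHS]/(field_value p q (z + a)).
have Eg : `[< good p' /\ good q' >] = `[< good p /\ good q >].
  apply: asbool_equiv_eq; have [pp1 pp2] := good_shiftedE pp'.
  have [qq1 qq2] := good_shiftedE qq'.
  by split=> -[gp gq]; split; [exact: pp1|exact: qq1|exact: pp2|exact: qq2].
have E1 : (approx1 p' q')^~ z = (approx1 p q)^~ (z + a).
  apply/funext => n; apply: eq_bigr => j _.
  by rewrite (increment_shifted _ _ pp') (dwave_shifted _ _ qq').
have E2 : (approx2 p' q')^~ z = (approx2 p q)^~ (z + a).
  apply/funext => n; apply: eq_bigr => j _.
  by rewrite (dincrement_shifted _ _ pp') (wave_shifted _ _ qq').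
have congr_field (b b' : bool) (u v u' v' : nat -> R) :
    b = b' -> u = u' -> v = v' ->
    (if b then (limn u, limn v) else (0, 0)) =
    (if b' then (limn u', limn v') else (0, 0)) by move=> -> -> ->.
exact: (congr_field _ _ _ _ _ _ Eg E1 E2).
Qed.

End Field.

(** * Measurability in the phases *)

Section Measurability.
Variable R : realType.
Context d (T : measurableType d).
Implicit Types (n j m : nat) (x : R).

Lemma measurable_fracpart :
  measurable_fun [set: measurableTypeR R]
    (@fracpart R : _ -> measurableTypeR R).
Proof.
apply: measurable_funB; first exact: measurable_id.
apply: nondecreasing_measurable => // s t st.
by rewrite ler_int; exact: le_floor.
Qed.

Section Phases.
Variable P : nat -> T -> measurableTypeR R.
Hypothesis mP : forall n, measurable_fun setT (P n).

Lemma measurable_good : measurable [set w | good (fun n => P n w)].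
Proof.
have -> : [set w | good (fun n => P n w)] =
    \bigcap_m \bigcup_N \bigcap_(n in [set n | (N <= n)%N])
      ((fun w => fracpart (P n w)) @^-1`
        [set t | m%:R * freq R n < t < 1 - m%:R * freq R n]).
  apply/seteqP; split=> w /= gw m.
    by move=> _; have [N wN] := gw m; exists N.
  have [N _ wN] := gw m I; exists N => n Nn.
  exact: wN.
apply: bigcapT_measurable => m; apply: bigcupT_measurable => N.
apply: bigcap_measurable => [|n _]; first by exists N => /=.
rewrite -[X in measurable X]setTI.
have : measurable_fun setT (fun w => fracpart (P n w) : measurableTypeR R).
  exact: (measurableT_comp measurable_fracpart).
by apply => //; rewrite -set_itvoo; exact: measurable_itv.
Qed.

Lemma measurable_comp_phase (f : R -> R) n (c : R) : continuous f ->
  measurable_fun setT (fun w => f (P n w + c) : measurableTypeR R).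
Proof.
move=> /continuous_measurable_fun mf.
apply: (measurableT_comp (f := f : measurableTypeR R -> measurableTypeR R) mf).
apply: (measurable_funD (f := P n) (g := cst c)); first exact: mP.
exact: measurable_cst.
Qed.

Lemma measurable_wave n x :
  measurable_fun setT (fun w => wave (P ^~ w) n x : measurableTypeR R).
Proof.
apply: measurable_funM => //; apply: measurable_comp_phase.
by apply: (@class_C1_continuous _ 0); exact: class_C1_saw (freq_itv R n).
Qed.

Lemma measurable_dwave n x :
  measurable_fun setT (fun w => dwave (P ^~ w) n x : measurableTypeR R).
Proof.
apply: measurable_comp_phase.
by case: (class_C1_saw 1 (freq_itv R n)).
Qed.

Lemma measurable_increment n x :
  measurable_fun setT (fun w => increment (P ^~ w) n x : measurableTypeR R).
Proof.
apply: measurable_funB; first exact: measurable_wave.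
by case: n => [|n]; [exact: measurable_cst|exact: measurable_wave].
Qed.

Lemma measurable_dincrement n x :
  measurable_fun setT (fun w => dincrement (P ^~ w) n x : measurableTypeR R).
Proof.
apply: measurable_funB; first exact: measurable_dwave.
by case: n => [|n]; [exact: measurable_cst|exact: measurable_dwave].
Qed.

End Phases.

Variables P Q : nat -> T -> measurableTypeR R.
Hypothesis mP : forall n, measurable_fun setT (P n).
Hypothesis mQ : forall n, measurable_fun setT (Q n).

Let G : set T := [set w | good (P ^~ w) /\ good (Q ^~ w)].

Let mG : measurable G.
Proof. by apply: measurableI; exact: measurable_good. Qed.

(** The limit exists only on the good event; cutting the sequence off outside
    it gives a sequence of measurable functions that converges everywhere. *)
Lemma measurable_lim_good (h : nat -> T -> measurableTypeR R) :
  (forall n, measurable_fun setT (h n)) ->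
  (forall w, G w -> cvgn (h ^~ w)) ->
  measurable_fun setT
    (fun w => if `[< G w >] then limn (h ^~ w) else 0 : measurableTypeR R).
Proof.
move=> mh ch.
apply: (@measurable_fun_cvg _ _ _ _
  (fun n w => if `[< G w >] then h n w else 0)).
  move=> n; apply: measurable_fun_ifT; [|exact: mh|exact: measurable_cst].
  apply: (@measurable_fun_bool _ _ _ _ true); rewrite setTI.
  rewrite [X in measurable X](_ : _ = G)//.
  by apply/seteqP; split=> w /= /asboolP.
move=> w _ /=; have [Gw|_] := asboolP (G w); last exact: cvg_cst.
exact: ch.
Qed.

Lemma measurable_field_value (z : R * R) :
  measurable_fun setT (fun w => field_value (P ^~ w) (Q ^~ w) z
    : measurableTypeR R * measurableTypeR R).
Proof.
have -> : (fun w => field_value (P ^~ w) (Q ^~ w) z) = (fun w =>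
    (if `[< G w >] then limn (fun n => approx1 (P ^~ w) (Q ^~ w) n z) else 0,
     if `[< G w >] then limn (fun n => approx2 (P ^~ w) (Q ^~ w) n z) else 0)).
  by apply/funext => w; rewrite /field_value -/(G w); case: ifP.
apply: measurable_fun_pair; apply: measurable_lim_good.
- move=> n; apply: measurable_sum => j; apply: measurable_funM.
    exact: measurable_increment.
  by apply: measurable_funB; [exact: measurable_cst|exact: measurable_dwave].
- by move=> w [_ gq]; apply: locally_stable_cvg; exact: locally_stable_approx1.
- move=> n; apply: measurable_sum => j; apply: measurable_funM.
    exact: measurable_dincrement.
  exact: measurable_wave.
- by move=> w [gp _]; apply: locally_stable_cvg; exact: locally_stable_approx2.
Qed.

Lemma measurable_phase_field :
  measurable_fun setT (fun w => phase_field (P ^~ w) (Q ^~ w)).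
Proof.
apply: (@measurability _ _ _ (smooth_field R) _ _ (@cylinders R) erefl).
move=> _ [_ [z [B [mB ->]]] <-].
exact: (measurable_field_value z measurableT mB).
Qed.

End Measurability.

(** * Measure-preserving rotations *)

Section Torus.
Variable R : realType.
Local Notation mu := (@lebesgue_measure R).
Local Notation TR := (measurableTypeR R).

(** By uniqueness of Lebesgue measure it suffices to compare lengths of half-
    open intervals. *)
Lemma lebesgue_measure_translation (c : R) (A : set TR) : measurable A ->
  mu ((fun t => t + c) @^-1` A) = mu A.
Proof.
move=> mA; have mc : measurable_fun setT (fun t : TR => t + c : TR).
  by apply: measurable_funD.
apply/esym; apply: (lebesgue_measure_unique
  (mu := pushforward mu (fun t => t + c : TR))) => //= _ [[a b]] _ <-.
rewrite /pushforward.
have -> : (fun t => t + c) @^-1` `]a, b]%classic = `](a - c), (b - c)]%classic.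
  by apply/seteqP; split=> t /=; rewrite !in_itv/= ltrBlDr lerBrDr.
rewrite !lebesgue_measure_itv/= !lte_fin ltrD2r.
by case: ifP => // _; rewrite -!EFinB; congr EFin; ring.
Qed.

(** The uniform distribution on [0, 1), which represents the circle R/Z; rot c
    is then the rotation by c. *)
Definition circle : set TR -> \bar R :=
  mrestr mu (measurable_itv `[0 : R, 1[).

HB.instance Definition _ := Measure.on circle.

Let circleT : circle setT = 1%E.
Proof.
by rewrite /circle /mrestr setTI lebesgue_measure_itv/= lte_fin ltr01 sube0.
Qed.

HB.instance Definition _ := Measure_isProbability.Build _ _ _ circle circleT.

Definition rot (c t : TR) : TR := fracpart (t + c).

Lemma measurable_rot c : measurable_fun setT (rot c).
Proof.
apply: (measurableT_comp (@measurable_fracpart R)).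
exact: measurable_funD.
Qed.

(** With s the fractional part of c, the rotation translates [0, 1 - s) onto
    [s, 1) and [1 - s, 1) onto [0, s). *)
Lemma circle_rot c (A : set TR) : measurable A ->
  circle (rot c @^-1` A) = circle A.
Proof.
move=> mA; rewrite /circle /mrestr.
pose s : R := fracpart c.
have /andP[s0 s1] : 0 <= s < 1 := fracpart_itv c.
have rotE t : rot c t = fracpart (t + s).
  rewrite /rot -(fracpartDz (t + s) (Num.floor c)) /s /fracpart.
  by congr (fracpart _); rewrite addrA addrNK.
clearbody s; have mL : measurable (A `&` `[s, 1[) by exact: measurableI.
have mH : measurable (A `&` `[0, s[) by exact: measurableI.
have -> : rot c @^-1` A `&` `[0, 1[ =
    ((fun t => t + s) @^-1` (A `&` `[s, 1[)) `|`
    ((fun t => t + (s - 1)) @^-1` (A `&` `[0, s[)).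
  apply/seteqP; split=> t /=; rewrite !in_itv/=.
    rewrite rotE => -[At t01]; have [ts|ts] := ltP (t + s) 1.
      left; move: At; rewrite (@fracpartE _ 0) ?subr0; last lra.
      by move=> At; split=> //; lra.
    right; move: At; rewrite (@fracpartE _ 1); last lra.
    by rewrite mulr1z addrA => At; split=> //; lra.
  rewrite rotE => -[] [At ts].
    by rewrite (@fracpartE _ 0) ?subr0; [split=> //; lra|lra].
  rewrite (@fracpartE _ 1); last lra.
  by rewrite -addrA; split=> //; lra.
rewrite measureU; first 1 last.
- rewrite -[X in measurable X]setTI.
  by have : measurable_fun setT (fun t : TR => t + s : TR);
    [exact: measurable_funD|apply].
- rewrite -[X in measurable X]setTI.
  by have : measurable_fun setT (fun t : TR => t + (s - 1) : TR);
    [exact: measurable_funD|apply].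
- apply/eqP/negPn/negP => /set0P[t [[_ +] [_ +]]] /=.
  by rewrite !set_itvE/=; move: (t : R) => {}t; lra.
pose L : set TR := A `&` `[s, 1[; pose H : set TR := A `&` `[0, s[.
transitivity (mu L + mu H)%E.
  by congr (_ + _)%E; exact: lebesgue_measure_translation.
transitivity (mu (H `|` L)).
  rewrite addeC; apply/esym; apply: measureU => //.
  apply/eqP/negPn/negP => /set0P[t [[_ +] [_ +]]] /=.
  by rewrite !set_itvE/=; move: (t : R) => {}t; lra.
congr (mu _); rewrite -setIUr; congr (_ `&` _).
by apply/seteqP; split=> t /=; rewrite !in_itv/=; [case; lra|
  have [ts|ts] := ltP t s => t01; [left|right]; lra].
Qed.

End Torus.

Lemma product_measure12 (R : realType) d1 d2 (T1 : measurableType d1)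
    (T2 : measurableType d2) (P1 : probability T1 R) (P2 : probability T2 R) X :
  measurable X -> (P1 \x P2)%E X = (P1 \x^ P2)%E X.
Proof.
apply: product_measure_unique => A B mA mB.
exact: product_measure2E.
Qed.

Section Preserving.
Variable R : realType.
Context d1 d2 (T1 : measurableType d1) (T2 : measurableType d2).
Variables (P1 : probability T1 R) (P2 : probability T2 R).
Variables (f1 : T1 -> T1) (f2 : T2 -> T2).
Hypotheses (mf1 : measurable_fun setT f1) (mf2 : measurable_fun setT f2).
Hypothesis P1f1 : forall A, measurable A -> P1 (f1 @^-1` A) = P1 A.
Hypothesis P2f2 : forall A, measurable A -> P2 (f2 @^-1` A) = P2 A.

Definition prod_map (w : T1 * T2) := (f1 w.1, f2 w.2).

Lemma measurable_prod_map : measurable_fun setT prod_map.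
Proof.
by apply: measurable_fun_pair; [apply: (measurableT_comp mf1)|
  apply: (measurableT_comp mf2)].
Qed.

(** A product of measure-preserving maps agrees with the product measure on
    rectangles, hence everywhere. *)
Lemma prod_preserving X : measurable X ->
  (P1 \x P2)%E (prod_map @^-1` X) = (P1 \x P2)%E X.
Proof.
move=> mX; apply/esym.
apply: (product_measure_unique (m' := pushforward (P1 \x P2)%E prod_map)) => //.
  exact: measurable_prod_map.
move=> mf A B mA mB; rewrite /pushforward.
have mA1 : measurable (f1 @^-1` A).
  by rewrite -[X in measurable X]setTI; exact: mf1.
have mB2 : measurable (f2 @^-1` B).
  by rewrite -[X in measurable X]setTI; exact: mf2.
rewrite -[LHS]/((P1 \x P2)%E ((f1 @^-1` A) `*` (f2 @^-1` B))).
by rewrite product_measure1E//; congr (_ * _)%E; [exact: P1f1|exact: P2f2].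
Qed.

End Preserving.

(** * Equidistributed phases on the torus *)

Section Phases.
Variable R : realType.
Local Notation TR := (measurableTypeR R).
Local Notation torus := (@circle R \x @circle R)%E.
Implicit Types (n m : nat) (w : TR * TR) (a : R).

(** The coordinates of freq n in the basis (1, sqrt 2); the recurrence is
    multiplication by sqrt 2 - 1. *)
Fixpoint freq_coef n : int * int :=
  if n is n'.+1 then
    let kl := freq_coef n' in (2 * kl.2 - kl.1, kl.1 - kl.2)
  else (-1, 1).

Lemma freq_coefE n :
  freq R n = (freq_coef n).1%:~R + (freq_coef n).2%:~R * Num.sqrt 2.
Proof.
have s2 : Num.sqrt 2 * Num.sqrt 2 = 2 :> R by rewrite -expr2 sqr_sqrtr.
elim: n => [|n IHn]; first by rewrite /freq/= expr1 mulrNz mulr1z; ring.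
rewrite /freq exprS -/(freq R n) IHn /= !intrB intrM.
by ring: s2.
Qed.

(** Otherwise freq n would be an integer strictly between 0 and 1. *)
Lemma freq_coef2_neq0 n : (freq_coef n).2 != 0.
Proof.
apply/eqP => l0; have := freq_itv R n; rewrite freq_coefE l0 mul0r addr0.
by rewrite -[X in X < _ < _]/(0%:~R) -[X in _ < _ < X]/(1%:~R) !ltr_int; lia.
Qed.

Definition phase n w : TR :=
  (freq_coef n).1%:~R * w.1 + (freq_coef n).2%:~R * w.2.

Lemma measurable_phase n : measurable_fun setT (phase n).
Proof.
apply: measurable_funD; apply: measurable_funM; first exact: measurable_cst.
- exact: measurable_fst.
- exact: measurable_cst.
- exact: measurable_snd.
Qed.

Lemma phase_rot n (b c : R) w : exists m : int,
  phase n (prod_map (@rot R b) (@rot R c) w) =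
  phase n w + ((freq_coef n).1%:~R * b + (freq_coef n).2%:~R * c) + m%:~R.
Proof.
exists (- ((freq_coef n).1 * Num.floor (w.1 + b) +
           (freq_coef n).2 * Num.floor (w.2 + c))).
rewrite /phase/= /rot /fracpart mulrNz intrD !intrM; ring.
Qed.

(** The linear flow in the direction (1, sqrt 2), which increases the n-th
    phase at speed freq n by freq_coefE. *)
Definition torus_flow a := prod_map (@rot R a) (@rot R (Num.sqrt 2 * a)).

Lemma phase_flow a w : shifted a (phase ^~ w) (phase ^~ (torus_flow a w)).
Proof.
move=> n; have [m ->] := phase_rot n a (Num.sqrt 2 * a) w.
by exists m; rewrite freq_coefE; ring.
Qed.

Lemma measurable_torus_rot (b c : R) :
  measurable_fun setT (prod_map (@rot R b) (@rot R c)).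
Proof. by apply: measurable_prod_map; exact: measurable_rot. Qed.

Lemma torus_rot (b c : R) (X : set (TR * TR)) : measurable X ->
  torus (prod_map (@rot R b) (@rot R c) @^-1` X) = torus X.
Proof.
move=> mX; apply: prod_preserving => //; try exact: measurable_rot.
- by move=> A mA; exact: circle_rot.
- by move=> A mA; exact: circle_rot.
Qed.

Lemma rotC (s t : TR) : rot s t = rot t s.
Proof. by rewrite /rot addrC. Qed.

Lemma rot_fracpart (c t : TR) : rot c (fracpart t) = fracpart (t + c).
Proof.
rewrite /rot -[RHS](fracpartDz _ (- Num.floor t)).
by congr fracpart; rewrite /fracpart mulrNz; ring.
Qed.

Lemma measurable_frac_phase n :
  measurable_fun setT (fun w => fracpart (phase n w) : TR).
Proof.
exact: (measurableT_comp (@measurable_fracpart R) (measurable_phase n)).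
Qed.

(** Rotating the second coordinate of the torus by c / l_n rotates the n-th
    phase by c, so the law of the phase on the circle is invariant under every
    rotation. Averaging over a uniform c and exchanging the integrals
    identifies this law: for a fixed torus point, a rotation by a uniform c
    gives a uniform point. *)
Lemma frac_phase_uniform n (A : set TR) : measurable A ->
  torus ((fun w => fracpart (phase n w)) @^-1` A) = @circle R A.
Proof.
move=> mA; pose g w : TR := fracpart (phase n w).
have mg : measurable_fun setT g := measurable_frac_phase n.
pose X : set ((TR * TR) * TR) := [set u | A (rot u.2 (g u.1))].
have mX : measurable X.
  have mrg : measurable_fun setT (fun u : (TR * TR) * TR => rot u.2 (g u.1)).
    apply: (measurableT_comp (@measurable_fracpart R)).
    apply: measurable_funD; last exact: measurable_snd.
    exact: (measurableT_comp mg measurable_fst).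
  by rewrite -[X in measurable X]setTI; exact: (mrg measurableT _ mA).
have mgA : measurable (g @^-1` A).
  by rewrite -[X in measurable X]setTI; exact: (mg measurableT _ mA).
have l0 : (freq_coef n).2%:~R != 0 :> R by rewrite intr_eq0 freq_coef2_neq0.
(* integrate over c first: rot c (g w) is uniform for each w *)
have EX1 : (torus \x @circle R)%E X = @circle R A.
  transitivity (\int[torus]_w (@circle R (xsection X w)))%E; first by [].
  rewrite (eq_integral (fun=> @circle R A)); last first.
    move=> w _ /=; rewrite -(circle_rot (g w) mA); congr (@circle R _).
    by apply/seteqP; split=> c; rewrite /xsection/= inE /X/= rotC.
  rewrite integral_cst// -[RHS]mule1; congr (_ * _)%E.
  exact: (probability_setT (torus : probability _ R)).
(* integrate over w first: the result does not depend on c *)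
have EX2 : (torus \x^ @circle R)%E X = torus (g @^-1` A).
  transitivity (\int[@circle R]_c (torus (ysection X c)))%E; first by [].
  rewrite (eq_integral (fun=> torus (g @^-1` A))); last first.
    move=> c _ /=; set b := (freq_coef n).2%:~R^-1 * c.
    have gE w : rot c (g w) = g (prod_map (@rot R 0) (@rot R b) w).
      rewrite rot_fracpart /g; have [m ->] := phase_rot n 0 b w.
      by rewrite fracpartDz mulr0 add0r mulVKf.
    rewrite -(torus_rot 0 b mgA); congr (torus _).
    by apply/seteqP; split=> w; rewrite /ysection/= inE /X/= gE.
  rewrite integral_cst// -[RHS]mule1; congr (_ * _)%E.
  exact: (probability_setT (@circle R : probability _ R)).
apply: (eq_trans (esym EX2)); apply: (eq_trans _ EX1); apply/esym.
exact: (@product_measure12 _ _ _ _ _ torus (@circle R) X mX).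
Qed.

Lemma measurable_near_int (e : R) :
  measurable ([set t | ~~ (e < t < 1 - e)] : set TR).
Proof.
rewrite (_ : [set t | _] = ~` [set t | e < t < 1 - e]); last first.
  by apply/seteqP; split=> t /= /negP.
by apply: measurableC; rewrite -set_itvoo; exact: measurable_itv.
Qed.

Lemma circle_near0_le (e : R) : 0 <= e ->
  (@circle R [set t | ~~ (e < t < 1 - e)%R] <= (e + e)%:E)%E.
Proof.
move=> e0; rewrite /circle /mrestr.
have mE (b c : R) :
    (b <= c)%R -> lebesgue_measure `[b, c]%classic = (c - b)%:E.
  move=> bc; rewrite lebesgue_measure_itv/= lte_fin.
  case: ltP => [_|cb]; first by rewrite EFinB.
  have -> : c = b by apply/le_anti; rewrite cb bc.
  by rewrite subrr.
have : ([set t | ~~ (e < t < 1 - e)%R] `&` `[0%R, 1%R[ `<=`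
    `[0%R, e] `|` `[(1 - e)%R, 1%R])%classic.
  move=> t; rewrite /= !in_itv/= negb_and -!leNgt => -[/orP[te|te] t01].
    by left; lra.
  by right; lra.
move=> /(@le_measure _ _ _ (@lebesgue_measure R)) le.
apply: (le_trans (le _ _)).
- by rewrite inE; apply: measurableI; [exact: measurable_near_int|].
- by rewrite inE; apply: measurableU; exact: measurable_itv.
pose I0 : set TR := `[0, e]%classic; pose I1 : set TR := `[1 - e, 1]%classic.
have -> : (e + e)%:E = (lebesgue_measure I0 + lebesgue_measure I1)%E.
  by rewrite !mE; [rewrite -EFinD; congr EFin; lra|lra|lra].
by apply: measureU2; exact: measurable_itv.
Qed.

(** Borel-Cantelli: for each m the events that the n-th phase is within m *
    freq n of an integer have summable probabilities. *)
Lemma ae_good : torus.-negligible (~` [set w | good (phase ^~ w)]).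
Proof.
pose F m n := [set w | ~~ (m%:R * freq R n < fracpart (phase n w)
  < 1 - m%:R * freq R n)].
have mF m n : measurable (F m n).
  rewrite -[X in measurable X]setTI.
  exact: (measurable_frac_phase n measurableT
    (measurable_near_int (m%:R * freq R n))).
have Fle m n : (torus (F m n) <= ((2 * m%:R) / (2 ^ n.+1)%:R)%:E)%E.
  have -> : torus (F m n) = _ :=
    frac_phase_uniform n (measurable_near_int (m%:R * freq R n)).
  have /andP[/ltW f0 _] := freq_itv R n.
  apply: (le_trans (circle_near0_le _)); first exact: mulr_ge0.
  have := ler_wpM2l (ler0n R m) (freq_le R n).
  by rewrite lee_fin natrX exprVn; lra.
have F0 m : torus (lim_sup_set (F m)) = 0%E.
  apply: lim_sup_set_cvg0 => //.
  apply: (@le_lt_trans _ _ (2 * m%:R)%:E); last exact: ltry.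
  apply: (@le_trans _ _ (\sum_(n <oo) ((2 * m%:R) / (2 ^ n.+1)%:R)%:E)%E).
    by apply: lee_nneseries => [*|n _]; [exact: measure_ge0|exact: Fle].
  by apply: epsilon_trick0; rewrite mulr_ge0.
apply: (@negligibleS _ _ _ _ (\bigcup_m lim_sup_set (F m))); last first.
  apply: negligible_bigcup => m; apply/negligibleP; last exact: F0.
  by apply: bigcapT_measurable => k; apply: bigcup_measurable.
move=> w; apply: contra_notP => nF m; apply: contrapT => nE; apply: nF.
exists m => // N _; apply: contrapT => nN; apply: nE; exists N => n Nn.
by apply: contrapT => /negP nF; apply: nN; exists n.
Qed.

End Phases.

Section Main.
Variable R : realType.
Local Notation TR := (measurableTypeR R).

Definition random_field (w : (TR * TR) * (TR * TR)) : smooth_field R :=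
  phase_field (@phase R ^~ w.1) (@phase R ^~ w.2).

Lemma measurable_random_field : measurable_fun setT random_field.
Proof.
apply: (measurable_phase_field
  (P := fun n (w : (TR * TR) * (TR * TR)) => phase n w.1)
  (Q := fun n w => phase n w.2)) => n.
  exact: (measurableT_comp (measurable_phase n) measurable_fst).
exact: (measurableT_comp (measurable_phase n) measurable_snd).
Qed.

HB.instance Definition _ := isMeasurableFun.Build _ _ _ (smooth_field R)
  random_field measurable_random_field.

End Main.

Theorem mainTheorem3 (R : realType) :
  exists (d : measure_display) (T : measurableType d) (P : probability T R)
         (V : {RV P >-> smooth_field R}),
    stationary V /\ {ae P, forall w, forall z, divergence (V w) z = 1}.
Proof.
pose torus : probability _ R := (@circle R \x @circle R)%E.
exists _, _, (torus \x torus)%E, (@random_field R); split.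
  move=> a A mA; rewrite /distribution /pushforward.
  pose flow := prod_map (@torus_flow R a.1) (@torus_flow R a.2).
  have flowE w : random_field (flow w) = shift_field a (random_field w).
    exact: (phase_field_shifted (phase_flow a.1 w.1) (phase_flow a.2 w.2)).
  rewrite (_ : _ @^-1` A = flow @^-1` (@random_field R @^-1` A)); last first.
    by apply/seteqP; split=> w /=; rewrite flowE.
  apply: prod_preserving.
  - exact: measurable_torus_rot.
  - exact: measurable_torus_rot.
  - by move=> X mX; exact: torus_rot.
  - by move=> X mX; exact: torus_rot.
  - rewrite -[X in measurable X]setTI.
    exact: (measurable_random_field measurableT mA).
have [N [mN N0 Nbad]] := ae_good R.
apply: (@negligibleS _ _ _ _ ((N `*` setT) `|` (setT `*` N))).
  move=> w /= nw; apply: contrapT => /not_orP[n1 n2]; apply: nw => z.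
  apply: divergence_phase_field; apply: contrapT => ng.
    by apply: n1; split=> //; exact: Nbad.
  by apply: n2; split=> //; exact: Nbad.
apply: negligibleU; apply/negligibleP; try exact: measurableX.
  transitivity (torus N * torus setT)%E; first exact: product_measure1E.
  by have -> : torus N = 0%E := N0; rewrite mul0e.
transitivity (torus setT * torus N)%E; first exact: product_measure1E.
by have -> : torus N = 0%E := N0; rewrite mule0.
Qed.
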